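(* Let $X$ be a compact Hausdorff space, $T:X\to X$ a surjective local homeomorphism, $G$ the associated Deaconu-Renault groupoid, $S\in C_c(G)$ the canonical isometry, $\mathcal{X}$ the Deaconu $C^*$-correspondence over $C(X)$, and $\iota:C(X)\to C^*(G)$, $\psi:\mathcal{X}\to C^*(G)$ the canonical maps (all defined in the context). Define $\beta:C(X)\to C(X)$ by $\beta(f)=f\circ T$. Then the following hold in $C^*(G)$: 1. $\iota(\beta(a))S=S\iota(a)$ for all $a\in C(X)$. 2. If $\{m_1,\dots,m_n\}\subseteq\mathcal{X}$ is a filter bank and $S_i:=\psi(m_i)$, then $\{S_i\}_{i=1}^n$ is a Cuntz family of isometries in $C^*(G)$ such that $\iota(\beta(a))S_i=S_i\iota(a)$ for all $a\in C(X)$ and $i=1,\dots,n$. 3. If $\{m_1,\dots,m_n\}\subseteq\mathcal{X}$ is a filter bank and $S_i:=\psi(m_i)$, then for all $a\in C(X)$, $$\iota(\beta(a))=\sum_{i=1}^nS_i\iota(a)S_i^*.$$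
   Context: $X$ is a compact Hausdorff space and $T:X\to X$ is a surjective local homeomorphism. The Deaconu-Renault groupoid is $$G=\{(x,n,y)\in X\times\mathbb{Z}\times X : T^k(x)=T^l(y)\text{ for some integers }k,l\ge 0\text{ with }n=k-l\},$$ with product $(x,n,y)(y,m,z)=(x,n+m,z)$ and inverse $(x,n,y)^{-1}=(y,-n,x)$. A basis for its topology is given by the sets $Z(U,V,k,l)=\{(x,k-l,y): x\in U,\ y\in V,\ T^k(x)=T^l(y)\}$, where $U,V\subseteq X$ are open, $T^k|_U$ and $T^l|_V$ are homeomorphisms onto their images, and $T^k(U)=T^l(V)$. The groupoid $G$ is étale; $C_c(G)$ is a $*$-algebra under $$(f*g)(x,n,y)=\sum_{(x,k,z)\in G} f(x,k,z)\,g(z,n-k,y),\qquad f^*(x,n,y)=\overline{f(y,-n,x)}.$$ $C^*(G)$ is the completion of $C_c(G)$ in the norm $\|f\|=\sup\|\pi(f)\|$, the supremum being over all $*$-homomorphisms $\pi$ of $C_c(G)$ into $\mathcal{B}(H_\pi)$, $H_\pi$ a Hilbert space, that are continuous for the inductive limit topology on $C_c(G)$ and the weak operator topology on $\mathcal{B}(H_\pi)$. The function $S\in C_c(G)$ is defined by $S(x,1,y)=|T^{-1}(Tx)|^{-1/2}$ if $Tx=y$, and $S=0$ at all other points of $G$, where $|\cdot|$ denotes cardinality. $S$ is an isometry in $C^*(G)$. The Deaconu $C^*$-correspondence $\mathcal{X}$ over $C(X)$ is the completion of $C(X)$ under the $C(X)$-valued inner product $$\langle\xi,\eta\rangle(x)=\frac{1}{|T^{-1}(x)|}\sum_{Ty=x}\overline{\xi(y)}\eta(y),$$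 with left and right actions of $C(X)$ given by $(a\cdot\xi\cdot b)(x)=a(x)\xi(x)b(Tx)$. The map $\iota:C(X)\to C^*(G)$ is given by $\iota(\varphi)(x,n,y)=\varphi(x)$ if $n=0$ and $x=y$, and $0$ otherwise. The map $\psi:\mathcal{X}\to C^*(G)$ is given by $\psi(\xi)=\iota(\xi)S$. A filter bank is a finite family $\{m_1,\dots,m_n\}\subseteq\mathcal{X}$ that is an orthonormal basis for $\mathcal{X}$: $\langle m_i,m_j\rangle=0$ for $i\ne j$, $\langle m_i,m_i\rangle=1$ (the constant function $1$ in $C(X)$), and every $\xi\in\mathcal{X}$ satisfies $\xi=\sum_{i=1}^nm_i\cdot\langle m_i,\xi\rangle$. A Cuntz family of isometries in a unital $C^*$-algebra is a finite family $\{S_i\}_{i=1}^n$ with $S_i^*S_j=\delta_{ij}1$ and $\sum_{i=1}^nS_iS_i^*=1$. *)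

(* Defs.v *)
From HB Require Import structures.
From mathcomp Require Import all_boot all_order all_algebra finmap.
From mathcomp Require Import all_classical all_reals all_analysis.
From mathcomp Require Import complex.

Set Implicit Arguments.
Unset Strict Implicit.
Unset Printing Implicit Defensive.

Import Order.TTheory GRing.Theory Num.Theory.
Import numFieldNormedType.Exports.

Local Open Scope classical_set_scope.
Local Open Scope ring_scope.

(* The complex numbers as a [numClosedFieldType], which is what gives them
   their norm topology. *)
Definition Cplx (R : realType) : numClosedFieldType := R[i].

(* Norms of modules over [Cplx R] take values in [Cplx R]; this is the norm
   as an element of [R]. *)
Definition rnorm (R : realType) (V : normedModType (Cplx R)) (v : V) : R :=
  complex.Re `|v|.

(** Local homeomorphisms *)

Definition homeo_onto_image (X : topologicalType) (U : set X) (f : X -> X) :=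
  {within U, continuous f} /\
  exists g : X -> X,
    {within f @` U, continuous g} /\ (forall x, U x -> g (f x) = x).

Definition local_homeo (X : topologicalType) (f : X -> X) :=
  forall x, exists U : set X,
    [/\ open U, U x, open (f @` U) & homeo_onto_image U f].

(** The Deaconu-Renault groupoid *)

Section groupoid.
Variables (X : topologicalType) (T : X -> X).

Definition dr_set : set (X * int * X) :=
  [set p | exists k l : nat,
     iter k T p.1.1 = iter l T p.2 /\ p.1.2 = k%:Z - l%:Z].

Record dr_groupoid := DR { dr_val : X * int * X; dr_valP : dr_set dr_val }.

Definition dr_rng (g : dr_groupoid) : X := (dr_val g).1.1.
Definition dr_deg (g : dr_groupoid) : int := (dr_val g).1.2.
Definition dr_src (g : dr_groupoid) : X := (dr_val g).2.

HB.instance Definition _ := gen_eqMixin dr_groupoid.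
HB.instance Definition _ := gen_choiceMixin dr_groupoid.

(* The index (U, V, k, l) stands for the basic set Z(U, V, k, l). *)
Definition dr_basic_index : set (set X * set X * (nat * nat)) :=
  [set i | let: (U, V, (k, l)) := i in
     [/\ open U, open V, homeo_onto_image U (iter k T),
         homeo_onto_image V (iter l T) & iter k T @` U = iter l T @` V]].

Definition dr_basic (i : set X * set X * (nat * nat)) : set dr_groupoid :=
  let: (U, V, (k, l)) := i in
  [set g | [/\ U (dr_rng g), V (dr_src g), dr_deg g = k%:Z - l%:Z &
               iter k T (dr_rng g) = iter l T (dr_src g)]].

(* The sets Z(U, V, k, l) form a basis, so the topology they generate as a
   subbasis is the one having them as a basis. *)
HB.instance Definition _ :=
  @isSubBaseTopological.Build dr_groupoid _ dr_basic_index dr_basic.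

End groupoid.

(** The *-algebra C_c(G).  Its elements are the functions satisfying [Cc];
    the operations are given by total formulas. *)

Section convolution_algebra.
Variables (R : realType) (X : topologicalType) (T : X -> X).
Local Notation C := (Cplx R).
Local Notation G := (dr_groupoid T).

Definition Cc (f : G -> C) : Prop :=
  continuous f /\ compact (closure [set g | f g != 0]).

(* The value of [f] at a triple, and 0 if the triple is not in the groupoid.
   In [dr_conv] and [dr_star] the triples are in the groupoid. *)
Definition at_triple (f : G -> C) (p : X * int * X) : C :=
  if pselect (dr_set T p) is left h then f (DR h) else 0.

(* The sum has finite support when f and g have compact support. *)
Definition dr_conv (f g : G -> C) : G -> C := fun c =>
  \sum_(h \in [set h : G | dr_rng h = dr_rng c])
     f h * at_triple g (dr_src h, dr_deg c - dr_deg h, dr_src c).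

Definition dr_star (f : G -> C) : G -> C := fun c =>
  (at_triple f (dr_src c, - dr_deg c, dr_rng c))^*.

(* The inductive limit topology on C_c(G) is the finest locally convex
   topology for which all the inclusions of C_K(G), K compact, with the
   uniform norm, are continuous.  A base of neighbourhoods of 0 is given by
   the absolutely convex subsets W of C_c(G) whose trace on every C_K(G) is
   a neighbourhood of 0. *)
Definition abs_convex (W : set (G -> C)) : Prop :=
  forall (f g : G -> C) (a b : C), W f -> W g -> `|a| + `|b| <= 1 ->
    W (fun c => a * f c + b * g c).

Definition indlim_base (W : set (G -> C)) : Prop :=
  [/\ W `<=` Cc, abs_convex W &
      forall K : set G, compact K -> exists2 e : C, 0 < e &
        forall f, Cc f -> (forall c, ~ K c -> f c = 0) ->
          (forall c, `|f c| <= e) -> W f].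

Definition indlim_nbhs (f : G -> C) : set_system (G -> C) :=
  [set N | exists2 W, indlim_base W &
     forall h, W h -> N (fun c => f c + h c)].

End convolution_algebra.

(** Hilbert spaces; the inner product is linear in the second variable. *)

Record hilbertSpace (R : realType) := HilbertSpace {
  hs_car :> completeNormedModType (Cplx R);
  hs_dot : hs_car -> hs_car -> Cplx R;
  hs_dot_linear : forall u (a : Cplx R) v w,
    hs_dot u (a *: v + w) = a * hs_dot u v + hs_dot u w;
  hs_dot_conj : forall u v, hs_dot v u = (hs_dot u v)^*;
  hs_dot_norm : forall u, hs_dot u u = `|u| ^+ 2 }.

(** The universal norm on C_c(G) *)

Section universal_norm.
Variables (R : realType) (X : topologicalType) (T : X -> X).
Local Notation C := (Cplx R).
Local Notation G := (dr_groupoid T).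

(* The *-homomorphisms from C_c(G) to B(H) that are continuous from the
   inductive limit topology to the weak operator topology, which is the
   initial topology for the maps A |-> <A v, w>.  Only the values of [p] on
   C_c(G) matter. *)
Record is_rep (H : hilbertSpace R) (p : (G -> C) -> {linear H -> H}) : Prop :=
  IsRep {
    rep_bounded : forall f, Cc f -> continuous (p f);
    rep_linear : forall (a : C) f g, Cc f -> Cc g -> forall v,
      p (fun c => a * f c + g c) v = a *: p f v + p g v;
    rep_conv : forall f g, Cc f -> Cc g -> forall v,
      p (dr_conv f g) v = p f (p g v);
    rep_star : forall f, Cc f -> forall v w,
      hs_dot (p (dr_star f) v) w = hs_dot v (p f w);
    rep_continuous : forall f, Cc f -> forall v w,
      (fun h => hs_dot (p h v) w) @ indlim_nbhs f --> hs_dot (p f v) w }.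

Definition opnorm (H : hilbertSpace R) (A : H -> H) : \bar R :=
  ereal_sup [set (rnorm (A v))%:E | v in [set v : H | `|v| <= 1]].

Definition cstar_norm (f : G -> C) : \bar R :=
  ereal_sup [set r | exists (H : hilbertSpace R)
    (p : (G -> C) -> {linear H -> H}), is_rep p /\ r = opnorm (p f)].

End universal_norm.

(** Unital C*-algebras.  The zero algebra is allowed. *)

Reserved Notation "x ** y" (at level 40, left associativity).

Record cstarAlgebra (R : realType) := CstarAlgebra {
  cs_car :> completeNormedModType (Cplx R);
  cs_mul : cs_car -> cs_car -> cs_car
    where "x ** y" := (cs_mul x y);
  cs_one : cs_car;
  cs_star : cs_car -> cs_car;
  cs_mulA : forall x y z, x ** (y ** z) = (x ** y) ** z;
  cs_mul1l : forall x, cs_one ** x = x;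
  cs_mul1r : forall x, x ** cs_one = x;
  cs_mul_linear_l : forall (a : Cplx R) x y z,
    (a *: x + y) ** z = a *: (x ** z) + y ** z;
  cs_mul_linear_r : forall (a : Cplx R) x y z,
    z ** (a *: x + y) = a *: (z ** x) + z ** y;
  cs_star_linear : forall (a : Cplx R) x y,
    cs_star (a *: x + y) = a^* *: cs_star x + cs_star y;
  cs_starM : forall x y, cs_star (x ** y) = cs_star y ** cs_star x;
  cs_starK : forall x, cs_star (cs_star x) = x;
  cs_normM : forall x y, `|x ** y| <= `|x| * `|y|;
  cs_star_norm : forall x, `|cs_star x ** x| = `|x| ^+ 2 }.

Notation "x ** y" := (cs_mul x y) : ring_scope.

Definition cuntz_family (R : realType) (A : cstarAlgebra R) (n : nat)
    (s : 'I_n -> A) : Prop :=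
  (forall i k, cs_star (s i) ** s k = if i == k then cs_one A else 0) /\
  \sum_(i < n) s i ** cs_star (s i) = cs_one A.

(** C*(G) *)

Section groupoid_cstar.
Variables (R : realType) (X : topologicalType) (T : X -> X).
Local Notation C := (Cplx R).
Local Notation G := (dr_groupoid T).

(* [A], together with the map [j] defined on C_c(G), is the completion of the
   *-algebra C_c(G) in the norm [cstar_norm].  This determines (A, j) up to a
   unique isomorphism.  Only the values of [j] on C_c(G) matter. *)
Record is_groupoid_cstar (A : cstarAlgebra R) (j : (G -> C) -> A) : Prop :=
  IsGroupoidCstar {
    gcs_linear : forall (a : C) f g, Cc f -> Cc g ->
      j (fun c => a * f c + g c) = a *: j f + j g;
    gcs_conv : forall f g, Cc f -> Cc g -> j (dr_conv f g) = j f ** j g;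
    gcs_star : forall f, Cc f -> j (dr_star f) = cs_star (j f);
    gcs_norm : forall f, Cc f -> (rnorm (j f))%:E = cstar_norm f;
    gcs_dense : dense (j @` [set f | Cc f]) }.

(* |T^-1(x)|; the fibres are finite when X is compact and T is a local
   homeomorphism. *)
Definition fibre_card (x : X) : nat := #|` fset_set (T @^-1` [set x])|.

Definition dr_S : G -> C := fun g =>
  if `[< dr_deg g = 1 /\ T (dr_rng g) = dr_src g >]
  then (sqrtC (fibre_card (T (dr_rng g)))%:R)^-1 else 0.

Definition dr_iota (phi : X -> C) : G -> C := fun g =>
  if `[< dr_deg g = 0 /\ dr_rng g = dr_src g >] then phi (dr_rng g) else 0.

End groupoid_cstar.

(** C*-correspondences over C(X): a right Hilbert C(X)-module with a left
    action of C(X) by adjointable operators.  The elements of C(X) are the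
    functions X -> C that are continuous, and only the values of the actions
    on such functions matter. *)

Record correspondence (R : realType) (X : topologicalType) :=
  Correspondence {
  co_car :> completeNormedModType (Cplx R);
  co_inner : co_car -> co_car -> X -> Cplx R;
  co_lact : (X -> Cplx R) -> co_car -> co_car;
  co_ract : co_car -> (X -> Cplx R) -> co_car;
  co_inner_cts : forall u v, continuous (co_inner u v);
  co_inner_linear : forall u (a : Cplx R) v w x,
    co_inner u (a *: v + w) x = a * co_inner u v x + co_inner u w x;
  co_inner_conj : forall u v x, co_inner v u x = (co_inner u v x)^*;
  co_inner_ge0 : forall u x, 0 <= co_inner u u x;
  co_inner_norm : forall u,
    rnorm u ^+ 2 = sup [set complex.Re (co_inner u u x) | x in [set: X]];
  co_inner_ract : forall u v (b : X -> Cplx R), continuous b -> forall x,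
    co_inner u (co_ract v b) x = co_inner u v x * b x;
  co_ract_linear : forall (a : Cplx R) u v (b : X -> Cplx R), continuous b ->
    co_ract (a *: u + v) b = a *: co_ract u b + co_ract v b;
  co_ract_linear_r : forall u (a : Cplx R) (b c : X -> Cplx R),
    continuous b -> continuous c ->
    co_ract u (fun x => a * b x + c x) = a *: co_ract u b + co_ract u c;
  co_ractM : forall u (b c : X -> Cplx R), continuous b -> continuous c ->
    co_ract u (fun x => b x * c x) = co_ract (co_ract u b) c;
  co_ract1 : forall u, co_ract u (fun=> 1) = u;
  co_lact_linear : forall (c : Cplx R) u v (a : X -> Cplx R), continuous a ->
    co_lact a (c *: u + v) = c *: co_lact a u + co_lact a v;
  co_lact_linear_l : forall u (c : Cplx R) (a b : X -> Cplx R),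
    continuous a -> continuous b ->
    co_lact (fun x => c * a x + b x) u = c *: co_lact a u + co_lact b u;
  co_lactM : forall u (a b : X -> Cplx R), continuous a -> continuous b ->
    co_lact (fun x => a x * b x) u = co_lact a (co_lact b u);
  co_inner_lact : forall u v (a : X -> Cplx R), continuous a -> forall x,
    co_inner (co_lact a u) v x = co_inner u (co_lact (fun y => (a y)^*) v) x }.

Section deaconu.
Variables (R : realType) (X : topologicalType) (T : X -> X).
Local Notation C := (Cplx R).

(* [E], together with the map [e] defined on C(X), is the completion of C(X)
   in the norm of the inner product displayed in [dc_inner]. *)
Record is_deaconu_correspondence (E : correspondence R X)
    (e : (X -> C) -> E) : Prop := IsDeaconu {
  dc_linear : forall (a : C) (xi eta : X -> C),
    continuous xi -> continuous eta ->
    e (fun x => a * xi x + eta x) = a *: e xi + e eta;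
  dc_inner : forall xi eta : X -> C,
    continuous xi -> continuous eta -> forall x,
    co_inner (e xi) (e eta) x =
      (fibre_card T x)%:R^-1 *
      \sum_(y \in T @^-1` [set x]) (xi y)^* * eta y;
  dc_actions : forall a xi b : X -> C,
    continuous a -> continuous xi -> continuous b ->
    co_ract (co_lact a (e xi)) b = e (fun x => a x * xi x * b (T x));
  dc_dense : dense (e @` [set xi : X -> C | continuous xi]) }.

Definition filter_bank (E : correspondence R X) (n : nat) (m : 'I_n -> E) :
    Prop :=
  [/\ forall i k, i != k -> co_inner (m i) (m k) = (fun=> 0),
      forall i, co_inner (m i) (m i) = (fun=> 1)
    & forall xi : E, xi = \sum_(i < n) co_ract (m i) (co_inner (m i) xi)].

(* psi : E -> C*(G) is the continuous map with psi(xi) = iota(xi) S for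
   xi in C(X). *)
Definition is_psi (A : cstarAlgebra R) (j : (dr_groupoid T -> C) -> A)
    (E : correspondence R X) (e : (X -> C) -> E) (psi : E -> A) : Prop :=
  continuous psi /\
  forall xi : X -> C, continuous xi ->
    psi (e xi) = j (dr_iota xi) ** j (@dr_S R X T).

End deaconu.

(* Main.v *)
Require Import Defs.
From mathcomp Require Import all_boot all_order all_algebra finmap.
From mathcomp Require Import all_classical all_reals all_analysis.
From mathcomp Require Import complex lra zify ring.

(* On functions everything is a computation in C_c(G): for [mu] in C(X) the
   element psi(mu) is supported on the graph {(x,1,Tx)}, the product
   psi(mu)^* psi(nu) is iota(<mu,nu>), and for (x,0,y) with Tx = Ty the value of
   sum_i psi(m_i) psi(m_i)^* is sum_i m_i(x) conj(m_i(y)) / |T^-1(Tx)|.  The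
   reconstruction formula of the filter bank, applied to a function that is 1 at
   y and 0 on the rest of its fibre, says that this number is 1 if x = y and 0
   otherwise, so the sum is iota(1).  Part 3 is then part 2 and the relation
   iota(beta a) S_i = S_i iota(a).
   No limits are needed in C*(G): since the fibres of T have bounded cardinality,
   the norm of the correspondence is equivalent to the uniform norm and every m_i
   is a continuous function. *)

Set Implicit Arguments.
Unset Strict Implicit.
Unset Printing Implicit Defensive.

Import Order.TTheory GRing.Theory Num.Theory.
Import numFieldNormedType.Exports.

Local Open Scope classical_set_scope.
Local Open Scope ring_scope.

(** * Local homeomorphisms of compact spaces *)

Lemma near_finite_set (I : Type) (T : Type) (F : set_system T) (D : set I)
    (P : I -> T -> Prop) : Filter F -> finite_set D ->
  (forall i, D i -> \forall y \near F, P i y) ->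
  \forall y \near F, forall i, D i -> P i y.
Proof.
(* The index type receives a choice structure, so that the finite set can be listed by a
   sequence. *)
move=> FF; elim/Pchoice : I => I in D P *.
move=> /finite_seqP[s ->]; elim: s => [|i s IHs] h.
  by apply: filterE => y i; rewrite /= in_nil.
have hs : forall k, [set` s] k -> \forall y \near F, P k y.
  by move=> k /= ks; apply: h; rewrite /= inE ks orbT.
have hi : \forall y \near F, P i y by apply: h; rewrite /= mem_head.
near=> y => k /=; rewrite inE => /orP[/eqP ->|ks]; first by near: y.
by move: k ks; near: y; exact: IHs.
Unshelve. all: by end_near.
Qed.

Lemma hausdorff_near_neq (X Y : topologicalType) (f g : Y -> X) (y : Y) :
  hausdorff_space X -> {for y, continuous f} -> {for y, continuous g} ->
  f y <> g y -> \forall z \near y, f z <> g z.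
Proof.
rewrite open_hausdorff => hX cf cg /eqP/hX[[A B]] /=.
rewrite !inE => -[Afy Bgy] [oA oB AB0].
have fA : \forall z \near y, A (f z) by apply: cf; exact: open_nbhs_nbhs.
have gB : \forall z \near y, B (g z) by apply: cg; exact: open_nbhs_nbhs.
near=> z => fgz; have : (A `&` B) (f z).
  by split; [|rewrite fgz]; near: z.
by rewrite AB0.
Unshelve. all: by end_near.
Qed.

(** Compactness as an induction principle for ideals of sets: if [P setT] failed, the complements of
    the members of [P] would form a proper filter, and a cluster point of it would have no
    neighbourhood in [P]. *)
Lemma compact_ideal (X : topologicalType) (P : set X -> Prop) :
  compact [set: X] -> P set0 -> (forall A B, P A -> P B -> P (A `|` B)) ->
  (forall A B : set X, B `<=` A -> P A -> P B) ->
  (forall x : X, exists2 U : set X, nbhs x U & P U) -> P setT.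
Proof.
move=> cX P0 PU PS Px; apply: contrapT => nP.
pose F : set_system X := [set A | P (~` A)].
have FF : ProperFilter F.
  split; first by rewrite /F /= setC0.
  split; first by rewrite /F /= setCT.
    by move=> A B FA FB; rewrite /F /= setCI; exact: PU.
  by move=> A B AB; apply: PS; exact: subsetC.
have [x [_ clx]] := cX F FF filterT; have [U Ux PU'] := Px x.
have FU : F (~` U) by rewrite /F /= setCK.
by have [y []] := clx _ _ FU Ux.
Qed.

(** Continuity, openness and local injectivity of [T] pass to [iter n T] by induction;
    [inj_homeo_onto_image] then recovers the homeomorphisms that basic sets of the groupoid
    require. *)
Definition open_map (X Y : topologicalType) (f : X -> Y) :=
  forall U : set X, open U -> open (f @` U).

Definition locally_inj (X : topologicalType) (Y : Type) (f : X -> Y) :=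
  forall x, exists U : set X, [/\ open U, U x & set_inj U f].

Section local_homeo.
Variable (X : topologicalType).
Implicit Types (f g : X -> X) (U : set X).

Lemma open_homeo_image f U V : open (f @` U) -> homeo_onto_image U f ->
  open V -> V `<=` U -> open (f @` V).
Proof.
move=> ofU [_ [g [cg gK]]] oV VU; rewrite openE => _ [x Vx <-].
have cgx : {for f x, continuous g}.
  move: cg; rewrite continuous_open_subspace// => /(_ (f x)); apply.
  by rewrite inE; exists x => //; exact: VU.
have V1 : \forall y \near f x, V (g y).
  by apply: cgx; apply: open_nbhs_nbhs; split => //; rewrite gK//; exact: VU.
have V2 : \forall y \near f x, (f @` U) y.
  by apply: open_nbhs_nbhs; split => //; exists x => //; exact: VU.
near=> y; have [z Uz zy] : (f @` U) y by near: y.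
exists z => //; have : V (g y) by near: y.
by rewrite -zy gK.
Unshelve. all: by end_near.
Qed.

Lemma local_homeo_continuous f : local_homeo f -> continuous f.
Proof.
move=> hf x; have [U [oU Ux _ [cf _]]] := hf x.
by move: cf; rewrite continuous_open_subspace// => /(_ x); apply; rewrite inE.
Qed.

Lemma local_homeo_open_map f : local_homeo f -> open_map f.
Proof.
move=> hf V oV; rewrite openE => _ [x Vx <-].
have [U [oU Ux ofU hU]] := hf x.
have oUV : open (f @` (U `&` V)).
  by apply: open_homeo_image hU _ _ => //; exact: openI.
rewrite /interior; apply: filterS (open_nbhs_nbhs (conj oUV _)); last by exists x.
by move=> _ [z [_ Vz] <-]; exists z.
Qed.

Lemma local_homeo_locally_inj f : local_homeo f -> locally_inj f.
Proof.
move=> hf x; have [U [oU Ux _ [_ [g [_ gK]]]]] := hf x.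
exists U; split => // y z; rewrite !inE => Uy Uz fyz.
by rewrite -(gK y Uy) fyz gK.
Qed.

Lemma continuous_iter f n : continuous f -> continuous (iter n f).
Proof.
move=> cf; elim: n => [|n IH] x; first exact: cvg_id.
exact: (@continuous_comp _ _ _ (iter n f) f x (IH x) (cf _)).
Qed.

Lemma open_map_iter f n : open_map f -> open_map (iter n f).
Proof.
move=> opf; elim: n => [|n IH] U oU; first by rewrite image_id.
rewrite (_ : iter n.+1 f = f \o iter n f)// -image_comp.
by apply: opf; exact: IH.
Qed.

Lemma locally_inj_iter f n : continuous f -> locally_inj f ->
  locally_inj (iter n f).
Proof.
move=> cf lf; elim: n => [|n IH] x.
  by exists setT; split=> [||? ? _ _ //]; first exact: openT.
have [U [oU Ux Uinj]] := IH x; have [V [oV Vx Vinj]] := lf (iter n f x).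
exists (U `&` iter n f @^-1` V); split => //.
  by apply: openI => //; apply: open_comp => // y _; exact: continuous_iter.
move=> y z; rewrite !inE => -[Uy Vy] [Uz Vz] /= /Vinj; rewrite !inE => E.
by apply: Uinj; rewrite ?inE//; exact: E.
Qed.

Lemma inj_homeo_onto_image f U : continuous f -> open_map f -> open U ->
  set_inj U f -> homeo_onto_image U f.
Proof.
move=> cf opf oU fU; split; first exact: continuous_subspaceT.
pose g y := if pselect (exists2 x, U x & f x = y) is left h
            then projT1 (cid2 h) else y.
have gK x : U x -> g (f x) = x.
  move=> Ux; rewrite /g; case: pselect => [h|[]]; last by exists x.
  by case: cid2 => z Uz zx /=; apply: fU; rewrite ?inE.
exists g; split => //; rewrite continuous_open_subspace; last exact: opf.
move=> _ /set_mem[x Ux <-] W; rewrite /= gK// nbhsE => -[V [oV Vx] VW].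
have : nbhs (f x) (f @` (U `&` V)).
  by apply: open_nbhs_nbhs; split; [apply: opf; exact: openI|exists x].
by apply: filterS => _ [z [Uz Vz] <-] /=; rewrite gK//; exact: VW.
Qed.

End local_homeo.

(** * Cardinality of the fibres *)

Section fibres.
Variables (X : topologicalType) (T : X -> X).
Hypotheses (X_compact : compact [set: X]) (X_hausdorff : hausdorff_space X)
  (T_local_homeo : local_homeo T).

Let T_cont := local_homeo_continuous T_local_homeo.
Let T_open := local_homeo_open_map T_local_homeo.
Let T_linj := local_homeo_locally_inj T_local_homeo.

(** By local injectivity every point has a neighbourhood that meets the fibre in at most one
    point. *)
Lemma finite_fibre y : finite_set (T @^-1` [set y]).
Proof.
pose P (A : set X) := finite_set (A `&` T @^-1` [set y]).
suff : P setT by rewrite /P setTI.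
apply: (compact_ideal X_compact); rewrite /P.
- by rewrite set0I.
- by move=> A B fA fB; rewrite setIUl finite_setU.
- by move=> A B BA; apply: sub_finite_set; exact: setSI.
move=> x; have [U [oU Ux Uinj]] := T_linj x.
exists U; first exact: open_nbhs_nbhs.
have [[z [Uz Tz]]|E] := pselect (U `&` T @^-1` [set y] !=set0).
  apply: (@sub_finite_set _ _ [set z]) => // w [Uw Tw].
  by apply: Uinj; rewrite ?inE//= Tw.
suff -> : U `&` T @^-1` [set y] = set0 by [].
by apply/eqP/negPn/negP => /set0P.
Qed.

(* Near [y] the fibre consists of the values of the finitely many local
   sections of [T] through the points of the fibre over [y]; they stay distinct
   since [X] is Hausdorff, and they exhaust the fibre since [T] is closed. *)
Lemma near_fibre_card y : \forall z \near y, fibre_card T z = fibre_card T y.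
Proof.
pose F := T @^-1` [set y]; have finF : finite_set F := finite_fibre y.
(* [F x] is a premise inside the existential, so that [choice] yields one function on all of [X]. *)
have sec x : exists Ug : set X * (X -> X), F x ->
    [/\ open Ug.1, Ug.1 x, Ug.2 y = x, {for y, continuous Ug.2} &
      (\forall z \near y, T (Ug.2 z) = z) /\ forall w, Ug.1 w -> Ug.2 (T w) = w].
  have [U [oU Ux ofU [_ [g [cg gK]]]]] := T_local_homeo x.
  exists (U, g) => Fx; have gy : g y = x by rewrite -Fx gK.
  split=> //=.
    move: cg; rewrite continuous_open_subspace// => /(_ y); apply.
    by rewrite inE -Fx; exists x.
  split=> //; have : nbhs y (T @` U).
    by apply: open_nbhs_nbhs; split => //; exists x.
  by apply: filterS => _ [w Uw <-]; rewrite gK.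
have {sec}[Ug UgP] := choice sec.
pose O := \bigcup_(x in F) (Ug x).1.
have oO : open O by apply: bigcup_open => x /UgP[].
have cTO : closed (T @` ~` O).
  apply: compact_closed => //; apply: continuous_compact.
    exact: continuous_subspaceT.
  by apply: (subclosed_compact _ X_compact) => //; exact: open_closedC.
have near1 : \forall z \near y, ~ (T @` ~` O) z.
  apply: open_nbhs_nbhs; split; first exact: closed_openC.
  by move=> [x Ox Txy]; apply: Ox; exists x => //; have [] := UgP x Txy.
have near2 : \forall z \near y, forall x, F x -> T ((Ug x).2 z) = z.
  by apply: near_finite_set => // x /UgP[_ _ _ _ []].
have near3 : \forall z \near y, forall p, (F `*` F) p -> p.1 <> p.2 ->
    (Ug p.1).2 z <> (Ug p.2).2 z.
  apply: near_finite_set; first exact: finite_setX.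
  move=> [x x'] [/= Fx Fx']; have [->|/eqP xx'] := eqVneq x x'.
    exact: filterE.
  have [_ _ gx cx _] := UgP x Fx; have [_ _ gx' cx' _] := UgP x' Fx'.
  have : \forall z \near y, (Ug x).2 z <> (Ug x').2 z.
    by apply: hausdorff_near_neq => //; rewrite gx gx'.
  by apply: filterS.
near=> z.
have n1 : ~ (T @` ~` O) z by near: z.
have n2 : forall x, F x -> T ((Ug x).2 z) = z by near: z.
have n3 : forall p, (F `*` F) p -> p.1 <> p.2 -> (Ug p.1).2 z <> (Ug p.2).2 z.
  by near: z.
pose h x := (Ug x).2 z.
have hF : T @^-1` [set z] = h @` F.
  apply/seteqP; split=> [w Twz|_ [x Fx <-]]; last exact: n2.
  have [x Fx Uxw] : O w by apply: contrapT => Ow; apply: n1; exists w.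
  by exists x => //; have [_ _ _ _ [_ Uk]] := UgP x Fx; rewrite /h -Twz Uk.
rewrite /fibre_card hF fset_set_image// card_in_imfset//= => x x'.
rewrite !in_fset_set// !inE => Fx Fx' hxx'; apply: contrapT => xx'.
exact: (n3 (x, x')).
Unshelve. all: by end_near.
Qed.

(** A locally constant function on a compact space is bounded. *)
Lemma fibre_card_bounded : exists N : nat, forall y, (fibre_card T y <= N)%N.
Proof.
pose P (A : set X) := exists N, forall y, A y -> (fibre_card T y <= N)%N.
suff [N NP] : P setT by exists N => y; exact: NP.
apply: (compact_ideal X_compact).
- by exists 0%N.
- move=> A B [M AM] [N BN]; exists (maxn M N) => y; rewrite leq_max.
  by move=> [/AM|/BN] ->; rewrite ?orbT.
- by move=> A B BA [M AM]; exists M => y /BA; exact: AM.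
- move=> x; exists [set z | fibre_card T z = fibre_card T x].
    exact: near_fibre_card.
  by exists (fibre_card T x) => y /= ->.
Qed.

Lemma fibre_card_gt0 x : (0 < fibre_card T (T x))%N.
Proof.
rewrite cardfs_gt0; apply/fset0Pn; exists x.
by rewrite in_fset_set ?inE//; exact: finite_fibre.
Qed.

Lemma continuous_comp_fibre_card (Y : topologicalType) (F : nat -> Y) :
  continuous (fun y => F (fibre_card T y)).
Proof.
move=> y; apply: (@near_cst_continuous _ _ (F (fibre_card T y))).
by near=> z; rewrite (near (near_fibre_card y) z).
Unshelve. all: by end_near.
Qed.

End fibres.

(** * Topology of the groupoid *)

(** The image of an ultrafilter decides every set, so each of its cluster points is a limit. *)
Lemma ultra_map_cvg (Y : Type) (Z : topologicalType) (f : Y -> Z)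
    (F : set_system Y) :
  compact [set: Z] -> UltraFilter F ->
  exists z : Z, f x @[x --> F] --> z.
Proof.
move=> cZ UF; have [z [_ clz]] := cZ (f x @[x --> F]) _ filterT.
exists z => A Az; have [//|FA] := in_ultra_setVsetC (f @^-1` A) UF.
by have [w []] := clz (~` A) A FA Az.
Qed.

Section groupoid_topology.
Variables (X : topologicalType) (T : X -> X).
Hypotheses (X_compact : compact [set: X]) (X_hausdorff : hausdorff_space X)
  (T_local_homeo : local_homeo T).
Local Notation G := (dr_groupoid T).

Let T_cont n : continuous (iter n T).
Proof. exact/continuous_iter/local_homeo_continuous. Qed.

Let T_open n : open_map (iter n T).
Proof. exact/open_map_iter/local_homeo_open_map. Qed.

Let T_linj n : locally_inj (iter n T).
Proof.
apply: locally_inj_iter; first exact: local_homeo_continuous.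
exact: local_homeo_locally_inj.
Qed.

Lemma dr_val_inj : injective (@dr_val X T).
Proof.
move=> [g gP] [h hP] /= gh; move: gP hP; rewrite gh => gP hP.
by congr DR; exact: Prop_irrelevance.
Qed.

Lemma dr_eq (g h : G) : dr_rng g = dr_rng h -> dr_deg g = dr_deg h ->
  dr_src g = dr_src h -> g = h.
Proof.
rewrite /dr_rng /dr_deg /dr_src => r d s; apply: dr_val_inj.
by move: (dr_val g) (dr_val h) r d s => [[? ?] ?] [[? ?] ?] /= -> -> ->.
Qed.

Lemma open_dr_basic i : dr_basic_index T i -> open (dr_basic i : set G).
Proof.
move=> Di; exists [set dr_basic i : set G]; last by rewrite bigcup_set1.
move=> _ ->; exists [fset i]%fset; last by rewrite set_fset1 bigcap_set1.
by move=> k; rewrite !inE => /eqP ->.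
Qed.

Lemma dr_cvgP (F : set_system G) (g : G) : Filter F ->
  (forall i, dr_basic_index T i -> dr_basic i g -> F (dr_basic i)) -> F --> g.
Proof.
move=> FF h A /=; rewrite nbhsE => -[_ [[B sB <-] [C BC Cg] sUBA]].
rewrite nbhs_filterE; apply: filterS sUBA _; apply: (@filterS _ _ _ C).
  by move=> ? ?; exists C.
have /sB [D sD IDeC] := BC; rewrite -IDeC; apply: filter_bigI => i Di.
have /sD := Di; rewrite inE => Ii; apply: h => //.
by move: Cg; rewrite -IDeC; apply.
Qed.

(** Every presentation [k], [l] of the degree of [g] persists nearby. This gives continuity of range
    and source, local constancy of the degree and openness of the graphs below. *)
Lemma near_dr_basic (g : G) (k l : nat) (A B : set X) :
  dr_deg g = k%:Z - l%:Z -> iter k T (dr_rng g) = iter l T (dr_src g) ->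
  nbhs (dr_rng g) A -> nbhs (dr_src g) B ->
  \forall h \near g, [/\ A (dr_rng h), B (dr_src h), dr_deg h = dr_deg g &
                       iter k T (dr_rng h) = iter l T (dr_src h)].
Proof.
move=> dg eg; rewrite nbhsE => -[A' [oA' A'g] A'A].
rewrite nbhsE => -[B' [oB' B'g] B'B].
have [U [oU Ug Uinj]] := T_linj k (dr_rng g).
have [V [oV Vg Vinj]] := T_linj l (dr_src g).
(* A basic set requires equal images of its two open sets; cutting both down to the preimages of [O]
   makes [O] their common image. *)
pose O := (iter k T @` (U `&` A')) `&` (iter l T @` (V `&` B')).
have oO : open O by apply: openI; apply: T_open; exact: openI.
pose U' := (U `&` A') `&` iter k T @^-1` O.
pose V' := (V `&` B') `&` iter l T @^-1` O.
have oU' : open U'.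
  by apply: openI; [exact: openI|apply: open_comp => // x _; exact: T_cont].
have oV' : open V'.
  by apply: openI; [exact: openI|apply: open_comp => // x _; exact: T_cont].
have Og : O (iter k T (dr_rng g)).
  by split; [exists (dr_rng g)|exists (dr_src g)].
have imU : iter k T @` U' = O.
  apply/seteqP; split=> [_ [x [_ Ox] <-] //|x Ox].
  by have [[y UAy yx] _] := Ox; exists y => //; split => //=; rewrite yx.
have imV : iter l T @` V' = O.
  apply/seteqP; split=> [_ [x [_ Ox] <-] //|x Ox].
  by have [_ [y VBy yx]] := Ox; exists y => //; split => //=; rewrite yx.
have Di : dr_basic_index T (U', V', (k, l)).
  split => //; last by rewrite imU imV.
    apply: inj_homeo_onto_image => // x y; rewrite !inE => -[[Ux _] _] [[Uy _] _].
    by apply: Uinj; rewrite inE.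
  apply: inj_homeo_onto_image => // x y; rewrite !inE => -[[Vx _] _] [[Vy _] _].
  by apply: Vinj; rewrite inE.
have : nbhs g (dr_basic (U', V', (k, l))).
  apply: open_nbhs_nbhs; split; first exact: open_dr_basic.
  by split => //; split => //=; rewrite -eg.
apply: filterS => h [[[_ A'h] _] [[_ B'h] _] dh eh].
by split => //; [exact: A'A|exact: B'B|rewrite dh].
Qed.

Lemma dr_rng_continuous : continuous (@dr_rng X T).
Proof.
move=> g A Ag; have [k [l [eg dg]]] := dr_valP g.
by apply: filterS (near_dr_basic dg eg Ag filterT) => h [].
Qed.

Lemma dr_src_continuous : continuous (@dr_src X T).
Proof.
move=> g A Ag; have [k [l [eg dg]]] := dr_valP g.
by apply: filterS (near_dr_basic dg eg filterT Ag) => h [].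
Qed.

Lemma near_dr_deg (g : G) : \forall h \near g, dr_deg h = dr_deg g.
Proof.
have [k [l [eg dg]]] := dr_valP g.
by apply: filterS (near_dr_basic dg eg filterT filterT) => h [].
Qed.

(** These compact open sets carry all functions of the proof: [0 0] is the unit space, [1 0] the
    graph of [T], [0 1] its inverse, and [1 1] consists of the pairs in a common fibre of [T]. *)
Definition dr_graph (p q : nat) : set G :=
  [set g | dr_deg g = p%:Z - q%:Z /\ iter p T (dr_rng g) = iter q T (dr_src g)].

Lemma near_dr_graph p q g : dr_graph p q g -> \forall h \near g, dr_graph p q h.
Proof.
move=> [dg eg].
apply: filterS (near_dr_basic dg eg filterT filterT) => h [_ _ dh eh].
by split=> //; rewrite dh.
Qed.

Lemma near_not_dr_graph p q g :
  ~ dr_graph p q g -> \forall h \near g, ~ dr_graph p q h.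
Proof.
move=> ng; have [dg|dg] := eqVneq (dr_deg g) (p%:Z - q%:Z); last first.
  near=> h; case=> dh _; move: dg; rewrite -dh.
  by rewrite (near (near_dr_deg g) h)// eqxx.
have : \forall h \near g, iter p T (dr_rng h) <> iter q T (dr_src h).
  apply: (@hausdorff_near_neq _ _ (iter p T \o @dr_rng X T)
    (iter q T \o @dr_src X T)) => //.
  - by apply: continuous_comp; [exact: dr_rng_continuous|exact: T_cont].
  - by apply: continuous_comp; [exact: dr_src_continuous|exact: T_cont].
  - by move=> eg; apply: ng.
by apply: filterS => h eh [].
Unshelve. all: by end_near.
Qed.

Lemma closed_dr_graph p q : closed (dr_graph p q).
Proof.
rewrite -openC openE => g ng; exact: near_not_dr_graph.
Qed.

(** Along an ultrafilter range and source converge, and continuity puts the limit on the graph.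
    Convergence in the groupoid asks for more: the relation for each presentation [k], [l] of a
    basic set around the limit must hold eventually. *)
Lemma compact_dr_graph p q : compact (dr_graph p q).
Proof.
rewrite compact_ultra => F UF FK.
have [x Fx] := ultra_map_cvg (@dr_rng X T) X_compact UF.
have [y Fy] := ultra_map_cvg (@dr_src X T) X_compact UF.
have Tx k : iter k T (dr_rng h) @[h --> F] --> iter k T x.
  exact: (continuous_cvg _ (T_cont (x := x)) Fx).
have Ty k : iter k T (dr_src h) @[h --> F] --> iter k T y.
  exact: (continuous_cvg _ (T_cont (x := y)) Fy).
have exy : iter p T x = iter q T y.
  apply: (cvg_unique X_hausdorff (Tx p)).
  apply: cvg_trans (Ty q); apply: near_eq_cvg.
  by apply: filterS FK => h [].
have gP : dr_set T (x, p%:Z - q%:Z, y) by exists p, q.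
pose g : G := DR gP.
exists g; split; first by split.
apply: dr_cvgP => -[[U V] [k l]] [oU oV _ _ _] [/= Ux Vy].
move=> dkl exy'; rewrite {1}/dr_deg /= in dkl.
have FU : \forall h \near F, U (dr_rng h) by apply: Fx; exact: open_nbhs_nbhs.
have FV : \forall h \near F, V (dr_src h) by apply: Fy; exact: open_nbhs_nbhs.
suff Fe : \forall h \near F, iter k T (dr_rng h) = iter l T (dr_src h).
  near=> h; have [dh _] : dr_graph p q h by near: h.
  by split; [near: h|near: h|rewrite dh|near: h].
have [pk|kp] := leqP p k.
  (* Since [k - l = p - q], applying [iter (k - p) T] to the relation for [p], [q] gives the one for
     [k], [l]. *)
  apply: filterS FK => h [_ eh].
  rewrite -(subnK pk) (_ : l = k - p + q)%N; last by lia.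
  by rewrite !iterD eh.
(* Here [iter (p - k) T] agrees at [iter k T (dr_rng h)] and
   [iter l T (dr_src h)], which are both close to [iter k T x], where it is
   injective. *)
have [W [oW Wx Winj]] := T_linj (p - k) (iter k T x).
have FWx : \forall h \near F, W (iter k T (dr_rng h)).
  by apply: (Tx k); exact: open_nbhs_nbhs.
have FWy : \forall h \near F, W (iter l T (dr_src h)).
  by apply: (Ty l); rewrite /= -exy'; exact: open_nbhs_nbhs.
near=> h; apply: Winj; first by rewrite inE; near: h.
  by rewrite inE; near: h.
rewrite -!iterD subnK; last exact: ltnW.
rewrite (_ : p - k + l = q)%N; last by lia.
by have [] : dr_graph p q h by near: h.
Unshelve. all: by end_near.
Qed.

(** * Functions supported on a graph *)

Variable R : realType.
Local Notation C := (Cplx R).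

Lemma Cc_dr_graph p q (f : G -> C) :
  continuous f -> (forall c, ~ dr_graph p q c -> f c = 0) -> Cc f.
Proof.
move=> cf f0; split=> //.
apply: (subclosed_compact _ (@compact_dr_graph p q)).
  exact: closed_closure.
rewrite [X in _ `<=` X](closure_id _).1; last exact: closed_dr_graph.
by apply: closureS => c /= /eqP fc; apply: contrapT => /f0.
Qed.

(** A common form for [iota], [S], the images of [psi], their adjoints and the products needed. Such
    a function is continuous because the graph is both open and closed. *)
Definition dr_sec (p q : nat) (f g : X -> C) : G -> C := fun c =>
  if `[< dr_graph p q c >] then f (dr_rng c) * g (dr_src c) else 0.

Lemma dr_sec_out p q f g c : ~ dr_graph p q c -> dr_sec p q f g c = 0.
Proof. by move=> nc; rewrite /dr_sec asboolF. Qed.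

Lemma dr_sec_continuous p q f g :
  continuous f -> continuous g -> continuous (dr_sec p q f g).
Proof.
move=> cf cg c; have [Kc|nKc] := pselect (dr_graph p q c); last first.
  apply: (@near_cst_continuous _ _ 0).
  by apply: filterS (near_not_dr_graph nKc) => h; exact: dr_sec_out.
have Ec : dr_sec p q f g c = f (dr_rng c) * g (dr_src c).
  by rewrite /dr_sec asboolT.
rewrite /continuous_at Ec.
suff : f (dr_rng h) * g (dr_src h) @[h --> nbhs c] --> f (dr_rng c) * g (dr_src c).
  apply: cvg_trans.
  apply: near_eq_cvg; first exact: nbhs_filter.
  by apply: filterS (near_dr_graph Kc) => h Kh; rewrite /dr_sec asboolT.
apply: cvgM.
  exact: (continuous_cvg _ (cf _) (@dr_rng_continuous c)).
exact: (continuous_cvg _ (cg _) (@dr_src_continuous c)).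
Qed.

Lemma Cc_dr_sec p q f g : continuous f -> continuous g -> Cc (dr_sec p q f g).
Proof.
move=> cf cg; apply: (@Cc_dr_graph p q); first exact: dr_sec_continuous.
by move=> c; exact: dr_sec_out.
Qed.

End groupoid_topology.

Arguments dr_sec {X} T {R} p q f g _.

(** * Convolution *)

Section convolution.
Variables (R : realType) (X : topologicalType) (T : X -> X).
Local Notation C := (Cplx R).
Local Notation G := (dr_groupoid T).

Lemma at_tripleE (f : G -> C) (g : G) :
  at_triple f (dr_rng g, dr_deg g, dr_src g) = f g.
Proof.
rewrite /at_triple; case: pselect => [h|[]].
  by congr f; exact: dr_eq.
by have := dr_valP g; rewrite /dr_rng /dr_deg /dr_src; case: (dr_val g) => [[]].
Qed.

Lemma at_triple_dr_sec p q (f g : X -> C) x n y :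
  at_triple (dr_sec T p q f g) (x, n, y) =
  if `[< n = p%:Z - q%:Z /\ iter p T x = iter q T y >] then f x * g y else 0.
Proof.
rewrite /at_triple; case: pselect => [h|h]; first by [].
case: asboolP => // -[dn e]; exfalso; apply: h.
by exists p, q.
Qed.

Lemma dr_iotaE (a : X -> C) : dr_iota a = dr_sec T 0 0 a (fun=> 1) :> (G -> C).
Proof. by apply/funext => c; rewrite /dr_iota /dr_sec mulr1. Qed.

Lemma dr_star_sec p q (f g : X -> C) :
  dr_star (dr_sec T p q f g) =
  dr_sec T q p (fun x => (g x)^*) (fun x => (f x)^*).
Proof.
apply/funext => c; rewrite /dr_star at_triple_dr_sec /dr_sec.
case: asboolP => [[d e]|h]; case: asboolP => [[d' e']|h'].
- by rewrite rmorphM mulrC.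
- by exfalso; apply: h'; split; [rewrite -[dr_deg c]opprK d opprB|].
- by exfalso; apply: h; split; [rewrite d' opprB|].
- by rewrite conjC0.
Qed.

(** For the case where the support of one factor leaves a single factorization of [c]. *)
Lemma dr_conv1 (f g : G -> C) (c h0 : G) : dr_rng h0 = dr_rng c ->
  (forall h, dr_rng h = dr_rng c -> h <> h0 ->
    f h * at_triple g (dr_src h, dr_deg c - dr_deg h, dr_src c) = 0) ->
  dr_conv f g c = f h0 * at_triple g (dr_src h0, dr_deg c - dr_deg h0, dr_src c).
Proof.
move=> h0c hh; rewrite /dr_conv -(@fsbig_widen _ _ _ _ [set h0]) ?fsbig_set1//.
  by move=> _ ->.
by move=> h [hc hh0]; exact: hh.
Qed.

Lemma dr_set_unit x : dr_set T (x, 0, x).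
Proof. by exists 0%N, 0%N. Qed.

Lemma dr_conv_iotal (a : X -> C) (f : G -> C) c :
  dr_conv (dr_iota a) f c = a (dr_rng c) * f c.
Proof.
rewrite (@dr_conv1 _ _ _ (DR (dr_set_unit (dr_rng c))))//.
  by rewrite {1}/dr_iota asboolT// subr0 at_tripleE.
move=> h hc hn; rewrite {1}/dr_iota asboolF ?mul0r// => -[dh sh].
by apply: hn; apply: dr_eq => //; rewrite -sh.
Qed.

Lemma dr_conv_iotar (a : X -> C) (f : G -> C) c :
  dr_conv f (dr_iota a) c = f c * a (dr_src c).
Proof.
rewrite (@dr_conv1 _ _ _ c)// dr_iotaE.
  by rewrite at_triple_dr_sec subrr asboolT// mulr1.
move=> h hc hn; rewrite at_triple_dr_sec asboolF ?mulr0// => -[dh /= sh].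
by apply: hn; apply: dr_eq => //; apply/eqP; rewrite eq_sym -subr_eq0 dh subrr.
Qed.

Lemma dr_set_shift x : dr_set T (x, 1, T x).
Proof. by exists 1%N, 0%N. Qed.

Lemma dr_set_coshift x : dr_set T (T x, -1, x).
Proof. by exists 0%N, 1%N. Qed.

(** The left factor forces the first arrow to be [(x, 1, T x)]; the remaining arrow to [y] lies in
    the support of the right factor exactly when [(x, y)] is a degree 0 pair with [T x = T y]. *)
Lemma dr_conv_sec10_sec01 (a b : X -> C) :
  dr_conv (dr_sec T 1 0 a (fun=> 1)) (dr_sec T 0 1 (fun=> 1) b) =
  dr_sec T 1 1 a b.
Proof.
apply/funext => c.
rewrite (@dr_conv1 _ _ _ (DR (dr_set_shift (dr_rng c))))//.
  rewrite at_triple_dr_sec {1}/dr_sec asboolT// /dr_sec mulr1 mul1r.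
  case: asboolP => [[/= d e]|h]; case: asboolP => [[/= d' e']|h'] //.
  - exfalso; apply: h'; split => //=.
    by move: d; rewrite /dr_deg /=; lia.
  - exfalso; apply: h; split => //=.
    by move: d'; rewrite /dr_deg /=; lia.
  - by rewrite mulr0.
move=> h hc hn; rewrite {1}/dr_sec asboolF ?mul0r// => -[dh sh].
by apply: hn; apply: dr_eq => //; rewrite -hc.
Qed.

(** A product [(x, -1, z) (z, 1, y)] of arrows in the supports has [x = T z = y], so the result
    lives on units and sums over the fibre. *)
Lemma dr_conv_sec01_sec10 (a b : X -> C) :
  dr_conv (dr_sec T 0 1 (fun=> 1) a) (dr_sec T 1 0 b (fun=> 1)) =
  dr_iota (fun y => \sum_(z \in T @^-1` [set y]) a z * b z) :> (G -> C).
Proof.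
apply/funext => c; rewrite /dr_conv /dr_iota; case: asboolP => [[d e]|nc].
  pose i z : G := DR (dr_set_coshift z).
  rewrite -(@fsbig_widen _ _ _ _ (i @` (T @^-1` [set dr_rng c]))).
  - rewrite fsbig_image; last first.
      by move=> z z' _ _ /(congr1 (@dr_src X T)).
    apply: eq_fsbigr => z; rewrite inE => /= zc.
    rewrite at_triple_dr_sec /dr_sec asboolT// mul1r asboolT ?mulr1//.
    by split; [rewrite d|rewrite /= -e].
  - by move=> _ [z zc <-].
  - move=> h /= [hc hn]; rewrite {1}/dr_sec.
    case: asboolP => [[dh eh]|]; last by rewrite mul0r.
    exfalso; apply: hn; exists (dr_src h); first by rewrite /= -hc.
    by apply: dr_eq.
rewrite fsbig1// => h hc; rewrite at_triple_dr_sec {1}/dr_sec.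
case: asboolP => [[dh eh]|]; last by rewrite mul0r.
case: asboolP => [[dh' eh']|]; last by rewrite mulr0.
exfalso; apply: nc; split; first by move: dh dh'; lia.
by rewrite -[RHS]/(iter 0 T (dr_src c)) -eh' -hc.
Qed.

End convolution.

(** * Complex-valued functions *)

Section complex_valued.
Variable R : realType.
Local Notation C := (Cplx R).

Lemma le_complex_Re (z w : C) : z <= w -> complex.Re z <= complex.Re w.
Proof. by rewrite lecE => /andP[]. Qed.

Lemma lt_complex_Re (z w : C) : z < w -> complex.Re z < complex.Re w.
Proof. by rewrite ltcE => /andP[]. Qed.

Lemma ge0_complex_ReK (z : C) : 0 <= z -> ((complex.Re z)%:C)%C = z.
Proof. by move=> z0; apply: RRe_real; exact: ger0_real. Qed.

Lemma real_complex_continuous : continuous (fun r : R => (r%:C)%C : C).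
Proof.
move=> r; apply/cvgrPdist_lt => /= e e0.
have Re0 : 0 < complex.Re e by have := lt_complex_Re e0.
have : nbhs r (ball r (complex.Re e)) by exact: nbhsx_ballx.
apply: filterS => s; rewrite -ball_normE /= => rs.
rewrite -(ge0_complex_ReK (ltW e0)) -rmorphB normc_def /=.
by rewrite expr0n addr0 sqrtr_sqr ltcR.
Qed.

Lemma conjc_continuous : continuous (fun z : C => z^*).
Proof.
move=> z; apply/(@cvgrPdist_lt _ _ _ _ (nbhs_filter z)) => /= e e0.
have : nbhs z (ball z e) by exact: nbhsx_ballx.
apply: (@filterS _ _ (nbhs_filter z)) => w.
by rewrite -ball_normE /= -rmorphB norm_conjC.
Qed.

Lemma rnorm_Re (V : normedModType C) (v : V) : `|v| = ((rnorm v)%:C)%C.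
Proof. by rewrite ge0_complex_ReK. Qed.

(** The norm of a correspondence is a [sup], which dominates its set only once that set is known to
    be bounded above. *)
Lemma compact_Re_ubound (X : topologicalType) (f : X -> C) :
  compact [set: X] -> continuous f ->
  has_ubound [set complex.Re (f x) | x in [set: X]].
Proof.
move=> cX cf.
pose P (A : set X) := exists M, forall x, A x -> complex.Re (f x) <= M.
suff [M MP] : P setT by exists M => _ [x _ <-]; exact: MP.
apply: (compact_ideal cX).
- by exists 0.
- move=> A B [M AM] [N BN]; exists (Num.max M N) => y; rewrite le_max.
  by move=> [/AM|/BN] ->; rewrite ?orbT.
- by move=> A B BA [M AM]; exists M => y /BA; exact: AM.
- move=> x; exists [set y | `|f x - f y| < 1].
    by have /cvgrPdist_lt := cf x; apply.
  exists (complex.Re (f x) + 1) => y /= fxy.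
  have : `|complex.Re (f y - f x)| <= 1.
    rewrite -lecR; apply: le_trans (normc_ge_Re _) _.
    by rewrite distrC; exact: ltW.
  rewrite raddfB /= => /(le_trans (ler_norm _)); lra.
Qed.

Lemma urysohn_point (X : topologicalType) (B : set X) (x : X) :
  compact [set: X] -> hausdorff_space X -> finite_set B -> ~ B x ->
  exists eta : X -> C, [/\ continuous eta, eta x = 1 & forall y, B y -> eta y = 0].
Proof.
move=> cX hX fB Bx.
have cl (A : set X) : finite_set A -> closed A.
  by move: A; apply/accessible_finite_set_closed; exact: hausdorff_accessible.
have [|f [cf f0 f1 _]] := @urysohn_ext_itv X R (compact_normal hX cX) B [set x]
  0 1 (cl _ fB) (cl _ (finite_set1 x)) _ ltr01.
  by apply/disjoints_subset => y By /= yx; apply: Bx; rewrite -yx.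
exists (fun y => ((f y)%:C)%C); split.
- by move=> y; exact: (continuous_cvg _ (@real_complex_continuous _) (cf y)).
- by rewrite (f1 (f x)) //; exists x.
- by move=> y By; rewrite (f0 (f y)) //; exists y.
Qed.

End complex_valued.

Lemma dense_approx (K : numFieldType) (V : normedModType K) (D : set V) (u : V)
  (r : K) : dense D -> 0 < r -> exists2 v, D v & `|u - v| < r.
Proof.
move=> dD r0; have [||v [uv Dv]] := dD (ball u r)°.
- by exists u; exact: nbhsx_ballx.
- exact: open_interior.
exists v => //; have := interior_subset uv.
by rewrite -ball_normE.
Qed.

(** * The correspondence *)

Section hilbert_module.
Variables (R : realType) (X : topologicalType) (E : correspondence R X).
Hypothesis X_compact : compact [set: X].
Local Notation C := (Cplx R).
Implicit Types (u v w : E) (x : X).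

Lemma co_inner0 u x : co_inner u 0 x = 0.
Proof.
have := co_inner_linear u 1 0 0 x; rewrite scaler0 addr0 mul1r => /eqP.
by rewrite -subr_eq0 opprD addNKr oppr_eq0 => /eqP.
Qed.

Lemma co_innerD u v w x :
  co_inner u (v + w) x = co_inner u v x + co_inner u w x.
Proof. by rewrite -[v]scale1r co_inner_linear mul1r scale1r. Qed.

Lemma co_innerZ u (a : C) v x : co_inner u (a *: v) x = a * co_inner u v x.
Proof. by rewrite -[a *: v]addr0 co_inner_linear co_inner0 addr0. Qed.

Lemma co_inner_sum u n (F : 'I_n -> E) x :
  co_inner u (\sum_(i < n) F i) x = \sum_(i < n) co_inner u (F i) x.
Proof.
apply: (big_morph (fun v => co_inner u v x)); last exact: co_inner0.
by move=> v w; exact: co_innerD.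
Qed.

Lemma co_inner_le u x : co_inner u u x <= `|u| ^+ 2.
Proof.
rewrite rnorm_Re -rmorphXn co_inner_norm -(ge0_complex_ReK (co_inner_ge0 u x)).
rewrite lecR; apply: ub_le_sup; last by exists x.
exact/compact_Re_ubound/co_inner_cts.
Qed.

Lemma le_norm_co_inner u (M : C) : 0 <= M ->
  (forall x, co_inner u u x <= M ^+ 2) -> `|u| <= M.
Proof.
move=> M0 uM; rewrite -(@ler_pXn2r _ 2)//; last exact: normr_ge0.
rewrite -(ge0_complex_ReK M0) rnorm_Re -!rmorphXn lecR co_inner_norm.
(* For empty [X] the norm is the [sup] of the empty set, which is 0 by convention. *)
have [[x _]|nX] := pselect ([set: X] !=set0); last first.
  rewrite (_ : [set _ | _ in _] = set0) ?sup0 ?exprn_ge0//.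
    by have := le_complex_Re M0.
  by apply/seteqP; split => // r [x _ _]; apply: nX; exists x.
apply: ge_sup; first by exists (complex.Re (co_inner u u x)); exists x.
move=> _ [y _ <-]; rewrite -lecR ge0_complex_ReK; last exact: co_inner_ge0.
by rewrite rmorphXn /= ge0_complex_ReK.
Qed.

(** Cauchy-Schwarz for the positive semidefinite form obtained by evaluating the inner product at
    [x]. *)
Lemma co_inner_CS v u x : co_inner v v x != 0 ->
  `|co_inner v u x| ^+ 2 <= co_inner v v x * co_inner u u x.
Proof.
move=> s0; set s := co_inner v v x; set t := co_inner v u x.
have s_ge0 : 0 <= s by exact: co_inner_ge0.
have s_gt0 : 0 < s by rewrite lt_neqAle eq_sym s0.
have sr : s^* = s by exact/CrealP/ger0_real.
(* The component of [u] orthogonal to [v] at the point [x]. *)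
pose w := (- (t / s)) *: v + u.
have vw : co_inner v w x = 0.
  by rewrite co_inner_linear -/s -/t mulNr divfK// addNr.
have uw : co_inner u w x = - (t / s) * t^* + co_inner u u x.
  by rewrite co_inner_linear (co_inner_conj v u).
have ww : co_inner w w x = - (t / s) * t^* + co_inner u u x.
  rewrite {2}/w co_inner_linear (co_inner_conj v w) vw conjC0 mulr0 add0r.
  rewrite (co_inner_conj u w) uw rmorphD /= -(co_inner_conj u u).
  congr (_ + _); rewrite !(rmorphM, rmorphN) /= fmorphV /= conjCK -/s sr. ring.
have := co_inner_ge0 w x; rewrite ww addrC mulNr subr_ge0 => h.
by rewrite normCK -ler_pdivrMl// mulrC mulrAC.
Qed.

End hilbert_module.

(** * The Deaconu correspondence consists of continuous functions *)

Section deaconu.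
Variables (R : realType) (X : topologicalType) (T : X -> X).
Hypotheses (X_compact : compact [set: X]) (X_hausdorff : hausdorff_space X)
  (T_local_homeo : local_homeo T).
Local Notation C := (Cplx R).
Variables (E : correspondence R X) (e : (X -> C) -> E).
Hypothesis E_deaconu : is_deaconu_correspondence T e.
Local Notation N := (fibre_card T).

(** Pairing with such a function turns evaluation at [x] into an inner product, which makes sense
    for every element of the completion. *)
Definition fibre_bump (eta : X -> C) x :=
  [/\ continuous eta, eta x = 1 & forall y, T y = T x -> y <> x -> eta y = 0].

Lemma ex_fibre_bump x : exists eta, fibre_bump eta x.
Proof.
have [||eta [ceta etax eta0]] :=
    @urysohn_point R X ((T @^-1` [set T x]) `\ x) x X_compact X_hausdorff.
- by apply: finite_setD; exact: finite_fibre.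
- by case=> _; apply.
by exists eta; split => // y Tyx yx; apply: eta0; split.
Qed.

Lemma co_inner_bump eta x (xi : X -> C) : fibre_bump eta x -> continuous xi ->
  co_inner (e eta) (e xi) (T x) = (N (T x))%:R^-1 * xi x.
Proof.
move=> [ceta etax eta0] cxi; rewrite (dc_inner E_deaconu)//; congr (_ * _).
rewrite -(@fsbig_widen _ _ _ _ [set x]) ?fsbig_set1 ?etax ?conjC1 ?mul1r//.
  by move=> _ ->.
by move=> y [/= Tyx yx]; rewrite eta0// conjC0 mul0r.
Qed.

Let N_gt0 x : 0 < (N (T x))%:R :> C.
Proof. by rewrite ltr0n; exact: fibre_card_gt0. Qed.

Let N_neq0 x : (N (T x))%:R != 0 :> C.
Proof. by rewrite gt_eqF. Qed.

(** The left side is the square of the would-be value of [u] at [x]. Cauchy-Schwarz applies with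
    [1 / N (T x)] as the inner square of the bump. *)
Lemma bump_co_inner_le eta x u : fibre_bump eta x ->
  `|(N (T x))%:R * co_inner (e eta) u (T x)| ^+ 2 <= (N (T x))%:R * `|u| ^+ 2.
Proof.
move=> bump_x; have [ceta etax _] := bump_x.
have s : co_inner (e eta) (e eta) (T x) = (N (T x))%:R^-1.
  by rewrite co_inner_bump// etax mulr1.
have := @co_inner_CS _ _ _ (e eta) u (T x).
rewrite s invr_eq0 N_neq0 => /(_ isT) h.
rewrite normrM exprMn ger0_norm; last exact: ltW.
rewrite expr2 -mulrA ler_pM2l//.
apply: le_trans (_ : (N (T x))%:R * ((N (T x))%:R^-1 * co_inner u u (T x)) <= _).
  by rewrite ler_pM2l.
by rewrite mulVKf//; exact: co_inner_le.
Qed.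

(** The inner square of [e xi] is an average of squared absolute values over a fibre. *)
Lemma deaconu_norm_le xi (M : C) : continuous xi -> 0 <= M ->
  (forall x, `|xi x| <= M) -> `|e xi| <= M.
Proof.
move=> cxi M0 xiM; apply: le_norm_co_inner => // y.
rewrite (dc_inner E_deaconu)// fsbig_finite; last exact: finite_fibre.
rewrite /fibre_card; set F := fset_set _.
have : \sum_(z <- F) (xi z)^* * xi z <= #|` F|%:R * M ^+ 2.
  rewrite mulr_natl -[leRHS](_ : \sum_(z <- F) M ^+ 2 = _); last first.
    by rewrite big_const_seq count_predT iter_addr_0.
  apply: ler_sum => z _; rewrite mulrC -normCK.
  by rewrite ler_pXn2r// nnegrE.
(* Over an empty fibre the average is 0, as the inverse of 0 is 0. *)
move=> h; have [->|F0] := eqVneq #|` F|%N 0%N.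
  by rewrite invr0 mul0r; exact: exprn_ge0.
by rewrite ler_pdivrMl// ltr0n lt0n.
Qed.

(* The norm of [E] is equivalent to the uniform norm, because the fibres of
   [T] have bounded cardinality, so that the completion adds nothing to
   C(X). *)
Lemma deaconu_surjective u : exists2 xi, continuous xi & u = e xi.
Proof.
have [eta etaP] := choice ex_fibre_bump.
have [Nm NmP] := fibre_card_bounded X_compact X_hausdorff T_local_homeo.
(* The successor makes [K] positive, and [K ^+ 2] bounds all fibre cardinalities. *)
pose K : C := Nm.+1%:R.
have K0 : 0 < K by rewrite ltr0n.
pose xi x := (N (T x))%:R * co_inner (e (eta x)) u (T x).
(* Density then exhibits [xi] as a uniform limit of continuous functions. *)
have xiP zeta x : continuous zeta -> `|xi x - zeta x| <= K * `|u - e zeta|.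
  move=> czeta; have := @bump_co_inner_le (eta x) x (u - e zeta) (etaP x).
  have -> : (N (T x))%:R * co_inner (e (eta x)) (u - e zeta) (T x) =
      xi x - zeta x.
    rewrite -scaleN1r co_innerD co_innerZ co_inner_bump// mulrDr mulN1r mulrN.
    by rewrite mulVKf.
  move=> h.
  rewrite -(@ler_pXn2r _ 2) ?nnegrE ?mulr_ge0//.
  apply: le_trans h _; rewrite exprMn; apply: ler_wpM2r.
    exact: exprn_ge0.
  rewrite /K -natrX ler_nat (leq_trans (NmP _))//.
  by rewrite -[Nm in (Nm <= _)%N]muln1 leq_mul.
have approx (r : C) : 0 < r -> exists2 zeta, continuous zeta & `|u - e zeta| < r.
  move=> r0; have [_ [zeta czeta <-] h] := dense_approx u (dc_dense E_deaconu) r0.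
  by exists zeta.
have cxi : continuous xi.
  move=> x; apply/(@cvgrPdist_lt _ _ _ _ (nbhs_filter x)) => /= r r0.
  have r3 : 0 < r / 3%:R by rewrite divr_gt0.
  have [zeta czeta h] := approx (r / 3%:R / K) (divr_gt0 r3 K0).
  have hz y : `|xi y - zeta y| < r / 3%:R.
    by apply: le_lt_trans (xiP zeta y czeta) _; rewrite mulrC -ltr_pdivlMr.
  have : \forall y \near x, `|zeta x - zeta y| < r / 3%:R.
    by have /cvgrPdist_lt := czeta x; apply.
  apply: filterS => y zxy.
  have -> : xi x - xi y =
      (xi x - zeta x) + (zeta x - zeta y) - (xi y - zeta y) by ring.
  have -> : r = r / 3%:R + r / 3%:R + r / 3%:R by field.
  apply: le_lt_trans (ler_normB _ _) _; rewrite ltrD//.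
  by apply: le_lt_trans (ler_normD _ _) _; rewrite ltrD.
exists xi => //; apply/eqP; rewrite -subr_eq0 -normr_le0.
apply/ler_addgt0Pr => r r0; rewrite add0r.
(* [K + 1] collects the distance from [u] to [e zeta] and [K] times it for the distance from
   [e zeta] to [e xi]. *)
have K1 : 0 < K + 1 by rewrite addr_gt0.
have [zeta czeta h] := approx (r / (K + 1)) (divr_gt0 r0 K1).
have -> : u - e xi = (u - e zeta) + (e zeta - e xi).
  by rewrite addrA subrK.
apply: le_trans (ler_normD _ _) _.
have -> : e zeta - e xi = e (fun x => -1 * xi x + zeta x).
  by rewrite (dc_linear E_deaconu)// scaleN1r addrC.
apply: (@le_trans _ _ (`|u - e zeta| + K * `|u - e zeta|)).
  rewrite lerD2l; apply: deaconu_norm_le.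
  - move=> x; apply: cvgD; last exact: czeta.
    by apply: cvgM; [exact: cvg_cst|exact: cxi].
  - by rewrite mulr_ge0// ltW.
  - by move=> x; rewrite mulN1r addrC distrC; exact: xiP.
rewrite -[X in X + _]mul1r -mulrDl addrC mulrC -ler_pdivlMr//.
exact: ltW.
Qed.

(** Both sides are the value at [x] of a bump [th] at [y]; the left one is computed from the
    reconstruction formula for [e th], paired with a bump at [x]. *)
Lemma filter_bank_coordinates n (m : 'I_n -> E) (mu : 'I_n -> X -> C) :
  filter_bank m -> (forall i, continuous (mu i)) ->
  (forall i, m i = e (mu i)) -> forall x y, T x = T y ->
  \sum_(i < n) mu i x * (mu i y)^* / (N (T x))%:R = (x == y)%:R.
Proof.
move=> [_ _ mP] cmu mE x y Txy.
have [eta bump_x] := ex_fibre_bump x; have [th bump_y] := ex_fibre_bump y.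
have [cth thy th0] := bump_y.
transitivity (th x); last first.
  by have [->//|/eqP xy] := eqVneq x y; rewrite th0.
have : th x = (N (T x))%:R * co_inner (e eta) (e th) (T x).
  by rewrite co_inner_bump// mulVKf.
rewrite (mP (e th)) co_inner_sum mulr_sumr => ->; apply: eq_bigr => i _.
rewrite co_inner_ract; last exact: co_inner_cts.
have -> : co_inner (m i) (e th) (T x) = (mu i y)^* / (N (T x))%:R.
  rewrite co_inner_conj Txy mE (co_inner_bump bump_y (cmu i)).
  by rewrite rmorphM /= fmorphV /= conjC_nat mulrC.
by rewrite mE (co_inner_bump bump_x (cmu i)) mulrA mulVKf// mulrA.
Qed.

End deaconu.

(** * The C*-algebra *)

Section cstar_algebra.
Variables (R : realType) (A : cstarAlgebra R).
Implicit Types x y z : A.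

Lemma cs_mulBr x y z : x ** (y - z) = x ** y - x ** z.
Proof. by rewrite -scaleN1r addrC cs_mul_linear_r scaleN1r addrC. Qed.

Lemma cs_mul_sumr x n (y : 'I_n -> A) :
  x ** (\sum_(i < n) y i) = \sum_(i < n) x ** y i.
Proof.
apply: (big_morph (cs_mul x)); last by have := cs_mulBr x 0 0; rewrite !subrr.
by move=> z w; rewrite -[z]scale1r cs_mul_linear_r !scale1r.
Qed.

End cstar_algebra.

(** * Functions on the groupoid inside its C*-algebra *)

Section groupoid_cstar.
Variables (R : realType) (X : topologicalType) (T : X -> X).
Hypotheses (X_compact : compact [set: X]) (X_hausdorff : hausdorff_space X)
  (T_local_homeo : local_homeo T).
Local Notation C := (Cplx R).
Local Notation G := (dr_groupoid T).
Variables (A : cstarAlgebra R) (j : (G -> C) -> A).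
Hypothesis A_cstar : is_groupoid_cstar j.

Let Cc_sec p q (f g : X -> C) : continuous f -> continuous g ->
  Cc (dr_sec T p q f g).
Proof. exact: Cc_dr_sec. Qed.

Let cst1_continuous : continuous (fun _ : X => 1 : C).
Proof. by move=> x; exact: cvg_cst. Qed.

Let Cc_graph p q (f : G -> C) :
  continuous f -> (forall c, ~ dr_graph p q c -> f c = 0) -> Cc f.
Proof. exact: Cc_dr_graph. Qed.

Lemma Cc_dr_iota (a : X -> C) : continuous a -> Cc (dr_iota a : G -> C).
Proof. by move=> ca; rewrite dr_iotaE; exact: Cc_sec. Qed.

Lemma gcs_zero : j (fun=> 0) = 0.
Proof.
have C0 : Cc (fun _ : G => 0 : C).
  by apply: (@Cc_graph 0 0); [exact: cst_continuous|].
have := gcs_linear A_cstar 1 C0 C0.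
rewrite scale1r (_ : (fun c => _) = (fun=> 0)); last first.
  by apply/funext => c; rewrite mulr0 addr0.
by move=> /eqP; rewrite -subr_eq0 opprD addNKr oppr_eq0 => /eqP.
Qed.

(** [gcs_linear] speaks of members of [Cc] only; a common graph carrying all supports keeps the
    partial sums in [Cc]. *)
Lemma gcs_sum_graph p q n (f : 'I_n -> G -> C) :
  (forall i, continuous (f i)) ->
  (forall i c, ~ dr_graph p q c -> f i c = 0) ->
  j (fun c => \sum_(i < n) f i c) = \sum_(i < n) j (f i).
Proof.
elim: n f => [|n IH] f cf f0.
  rewrite big_ord0 -gcs_zero; congr j; apply/funext => c; exact: big_ord0.
rewrite big_ord_recl -IH => [||i c nc]; [|by move=> i; exact: cf|exact: f0].
pose g c := \sum_(i < n) f (lift ord0 i) c.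
have Cg : Cc g.
  apply: (@Cc_graph p q).
    by apply: continuous_big => [|i _]; [exact: add_continuous|exact: cf].
  by move=> c nc; rewrite /g big1// => i _; exact: f0.
have Cf : Cc (f ord0).
  by apply: (@Cc_graph p q); [exact: cf|exact: f0].
rewrite -[j (f ord0)]scale1r -(gcs_linear A_cstar 1 Cf Cg); congr j.
by apply/funext => c; rewrite big_ord_recl mul1r.
Qed.

(** [u] is a left unit for the dense image of [Cc], hence equals the unit of [A]. *)
Lemma gcs_iota1 : j (dr_iota (fun=> 1)) = cs_one A.
Proof.
set u := j _; apply/eqP; rewrite -subr_eq0 -normr_le0.
apply/ler_addgt0Pr => r r0; rewrite add0r.
have u1 : 0 < `|u| + 1 by rewrite ltr_wpDl.
have [_ [f Cf <-] h] :=
  dense_approx (cs_one A) (gcs_dense A_cstar) (divr_gt0 r0 u1).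
have uf : u ** j f = j f.
  rewrite /u -(gcs_conv A_cstar _ Cf); last exact/Cc_dr_iota/cst1_continuous.
  by congr j; apply/funext => c; rewrite dr_conv_iotal mul1r.
(* This difference has norm at most [|u| + 1] times the distance from [j f] to the unit. *)
have -> : u - cs_one A = u ** (cs_one A - j f) - (cs_one A - j f).
  by rewrite cs_mulBr cs_mul1r uf opprB addrA subrK.
apply: le_trans (ler_normB _ _) _.
apply: le_trans (lerD (cs_normM _ _) (lexx _)) _.
rewrite -[X in _ + X]mul1r -mulrDl mulrC -ler_pdivlMr//.
exact: ltW.
Qed.

Definition fibre_weight (x : X) : C := (sqrtC (fibre_card T (T x))%:R)^-1.

Lemma fibre_weight_continuous : continuous fibre_weight.
Proof.
move=> x; apply: (@continuous_comp _ _ _ T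
  (fun y => (sqrtC (fibre_card T y)%:R)^-1 : C)).
  exact: local_homeo_continuous.
exact: (@continuous_comp_fibre_card _ T X_compact X_hausdorff T_local_homeo _
  (fun n => (sqrtC n%:R)^-1 : C)).
Qed.

Lemma conj_fibre_weight x : (fibre_weight x)^* = fibre_weight x.
Proof. by apply/CrealP/ger0_real; rewrite invr_ge0 sqrtC_ge0. Qed.

Lemma sqr_fibre_weight x :
  fibre_weight x * fibre_weight x = (fibre_card T (T x))%:R^-1.
Proof. by rewrite -expr2 exprVn sqrtCK. Qed.

Lemma dr_SE : @dr_S R X T = dr_sec T 1 0 fibre_weight (fun=> 1).
Proof.
by apply/funext => c; rewrite /dr_S /dr_sec mulr1.
Qed.

Lemma Cc_dr_S : Cc (@dr_S R X T).
Proof.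
rewrite dr_SE; apply: Cc_sec; first exact: fibre_weight_continuous.
exact: cst1_continuous.
Qed.

Lemma gcs_iotaM (a b : X -> C) : continuous a -> continuous b ->
  j (dr_iota a) ** j (dr_iota b) = j (dr_iota (fun x => a x * b x)).
Proof.
move=> ca cb; rewrite -(gcs_conv A_cstar); [|exact: Cc_dr_iota..].
congr j; apply/funext => c; rewrite dr_conv_iotal /dr_iota.
by case: ifP => _; rewrite ?mulr0.
Qed.

(** [S] lives on the points [(x, 1, T x)], where [a \o T] at the range is [a] at the source. *)
Lemma gcs_iotaS (a : X -> C) : continuous a ->
  j (dr_iota (a \o T)) ** j (@dr_S R X T) = j (@dr_S R X T) ** j (dr_iota a).
Proof.
move=> ca; have caT : continuous (a \o T).
  move=> x; apply: continuous_comp; last exact: ca.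
  exact: local_homeo_continuous.
rewrite -!(gcs_conv A_cstar); try exact: Cc_dr_S; try exact: Cc_dr_iota.
congr j; apply/funext => c; rewrite dr_conv_iotal dr_conv_iotar mulrC.
by rewrite /dr_S /=; case: asboolP => [[_ ->]//|_]; rewrite !mul0r.
Qed.

(** The function on the groupoid that represents [psi (e mu)]. *)
Definition dr_psi (mu : X -> C) : G -> C :=
  dr_sec T 1 0 (fun x => mu x * fibre_weight x) (fun=> 1).

Lemma dr_psi_coef_continuous (mu : X -> C) : continuous mu ->
  continuous (fun x => mu x * fibre_weight x).
Proof.
by move=> cmu x; apply: cvgM; [exact: cmu|exact: fibre_weight_continuous].
Qed.

Lemma Cc_dr_psi (mu : X -> C) : continuous mu -> Cc (dr_psi mu).
Proof.
move=> cmu; apply: Cc_sec; last exact: cst1_continuous.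
exact: dr_psi_coef_continuous.
Qed.

Lemma gcs_psiE (mu : X -> C) : continuous mu ->
  j (dr_iota mu) ** j (@dr_S R X T) = j (dr_psi mu).
Proof.
move=> cmu; rewrite -(gcs_conv A_cstar); [|exact: Cc_dr_iota|exact: Cc_dr_S].
congr j; apply/funext => c; rewrite dr_conv_iotal dr_SE /dr_psi /dr_sec.
by case: asboolP => _; rewrite ?mulr0// mulrA.
Qed.

Lemma dr_star_psi (mu : X -> C) : dr_star (dr_psi mu) =
  dr_sec T 0 1 (fun=> 1) (fun x => (mu x * fibre_weight x)^*).
Proof.
by rewrite dr_star_sec; congr dr_sec; apply/funext => x; rewrite conjC1.
Qed.

Lemma Cc_dr_star_psi (mu : X -> C) : continuous mu -> Cc (dr_star (dr_psi mu)).
Proof.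
move=> cmu; rewrite dr_star_psi; apply: Cc_sec; first exact: cst1_continuous.
move=> x; apply: (continuous_cvg _ (@conjc_continuous R _)).
exact: dr_psi_coef_continuous.
Qed.

Variables (E : correspondence R X) (e : (X -> C) -> E).
Hypothesis E_deaconu : is_deaconu_correspondence T e.

(** The two weights multiply to the reciprocal of the fibre cardinality, which turns the fibre sum
    of the convolution into the inner product. *)
Lemma gcs_psi_starM (mu nu : X -> C) : continuous mu -> continuous nu ->
  cs_star (j (dr_psi mu)) ** j (dr_psi nu) =
  j (dr_iota (co_inner (e mu) (e nu))).
Proof.
move=> cmu cnu; rewrite -(gcs_star A_cstar); last exact: Cc_dr_psi.
rewrite -(gcs_conv A_cstar); [|exact: Cc_dr_star_psi|exact: Cc_dr_psi].
rewrite dr_star_psi dr_conv_sec01_sec10; congr (j (dr_iota _)).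
apply/funext => y; rewrite (dc_inner E_deaconu)//.
have fy : finite_set (T @^-1` [set y]) by exact: finite_fibre.
rewrite !fsbig_finite// mulr_sumr; apply: eq_big_seq => z.
rewrite in_fset_set// inE /= => <-.
rewrite rmorphM /= conj_fibre_weight -sqr_fibre_weight; ring.
Qed.

Lemma gcs_psi_cuntz n (m : 'I_n -> E) (mu : 'I_n -> X -> C) :
  filter_bank m -> (forall i, continuous (mu i)) ->
  (forall i, m i = e (mu i)) -> cuntz_family (fun i => j (dr_psi (mu i))).
Proof.
move=> fb cmu mE; have [m0 m1 _] := fb; split=> [i k|].
  rewrite gcs_psi_starM; [|exact: cmu..]; rewrite -!mE.
  have [<-|ik] := eqVneq i k; first by rewrite m1 gcs_iota1.
  rewrite m0// -gcs_zero; congr j; apply/funext => c.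
  by rewrite /dr_iota; case: ifP.
pose a i x := mu i x * fibre_weight x.
have ca i : continuous (a i) by apply: dr_psi_coef_continuous; exact: cmu.
pose f i := dr_sec T 1 1 (a i) (fun x => (a i x)^*).
have jf i : j (dr_psi (mu i)) ** cs_star (j (dr_psi (mu i))) = j (f i).
  rewrite -(gcs_star A_cstar); last exact/Cc_dr_psi/cmu.
  rewrite -(gcs_conv A_cstar); [|exact/Cc_dr_psi/cmu|exact/Cc_dr_star_psi/cmu].
  by rewrite dr_star_psi dr_conv_sec10_sec01.
rewrite (eq_bigr _ (fun i _ => jf i)) -(@gcs_sum_graph 1 1); last first.
- by move=> i c; exact: dr_sec_out.
- move=> i; apply: dr_sec_continuous; [by []..|exact: ca|] => x.
  by apply: (continuous_cvg _ (@conjc_continuous R _)); exact: ca.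
rewrite -gcs_iota1; congr j; apply/funext => c; rewrite /f /dr_sec /dr_iota.
(* Units lie on [dr_graph 1 1], so off it both sides vanish; on it the claim is the coordinate
   identity. *)
case: asboolP => [[d eT]|nc]; last first.
  rewrite big1// asboolF// => -[d eT]; apply: nc; split; rewrite ?d ?eT//.
transitivity ((dr_rng c == dr_src c)%:R : C); last first.
  case: eqVneq => [ec|nec]; first by rewrite asboolT// d subrr.
  by rewrite asboolF// => -[_ /eqP]; apply/negP.
rewrite -(filter_bank_coordinates X_compact X_hausdorff T_local_homeo E_deaconu
  fb cmu mE eT); apply: eq_bigr => i _.
rewrite /a rmorphM /= conj_fibre_weight -sqr_fibre_weight.
have -> : fibre_weight (dr_src c) = fibre_weight (dr_rng c).
  by rewrite /fibre_weight; move: eT => /= ->.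
ring.
Qed.

End groupoid_cstar.

(** * The relations in C*(G) and the Cuntz family of a filter bank *)

Theorem theorem4p3 (R : realType) (X : topologicalType) (T : X -> X)
  (X_compact : compact [set: X]) (X_hausdorff : hausdorff_space X)
  (T_surjective : forall y, exists x, T x = y) (T_local_homeo : local_homeo T)
  (A : cstarAlgebra R) (j : (dr_groupoid T -> Cplx R) -> A)
  (A_cstar : is_groupoid_cstar j)
  (E : correspondence R X) (e : (X -> Cplx R) -> E)
  (E_deaconu : is_deaconu_correspondence T e)
  (psi : E -> A) (psiP : is_psi j e psi) :
  let iota := fun phi : X -> Cplx R => j (dr_iota phi) in
  let S := j (@dr_S R X T) in
  let beta := fun f : X -> Cplx R => f \o T in
  [/\ forall a : X -> Cplx R, continuous a -> iota (beta a) ** S = S ** iota a,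
      forall (n : nat) (m : 'I_n -> E), filter_bank m ->
        cuntz_family (fun i => psi (m i)) /\
        (forall a : X -> Cplx R, continuous a -> forall i,
           iota (beta a) ** psi (m i) = psi (m i) ** iota a)
    & forall (n : nat) (m : 'I_n -> E), filter_bank m ->
        forall a : X -> Cplx R, continuous a ->
          iota (beta a) = \sum_(i < n) psi (m i) ** iota a ** cs_star (psi (m i))].
Proof.
move=> iota S beta.
have T_cont := local_homeo_continuous T_local_homeo.
have iotaS a : continuous a -> iota (beta a) ** S = S ** iota a.
  exact: gcs_iotaS.
have cbeta a : continuous a -> continuous (beta a).
  by move=> ca x; apply: continuous_comp; [exact: T_cont|exact: ca].
(* Writing [u] as [e mu], part 1 moves [iota (beta a)] past [S], and it commutes with [iota mu]
   because C(X) is commutative. *)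
have psi_iota u a : continuous a -> iota (beta a) ** psi u = psi u ** iota a.
  move=> ca; have [mu cmu ->] :=
    deaconu_surjective X_compact X_hausdorff T_local_homeo E_deaconu u.
  rewrite psiP.2// -/S -/(iota mu) -cs_mulA -iotaS// !cs_mulA.
  pose iotaM := gcs_iotaM X_compact X_hausdorff T_local_homeo A_cstar.
  rewrite (iotaM _ _ (cbeta a ca) cmu) (iotaM _ _ cmu (cbeta a ca)).
  by congr (_ ** _); congr (j (dr_iota _)); apply/funext => x; rewrite mulrC.
have psi_cuntz n (m : 'I_n -> E) : filter_bank m ->
    cuntz_family (fun i => psi (m i)).
  move=> fb.
  have ex_mu i : exists xi : X -> Cplx R, continuous xi /\ m i = e xi.
    have [xi cxi ->] :=
      deaconu_surjective X_compact X_hausdorff T_local_homeo E_deaconu (m i).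
    by exists xi.
  have [mu muP] := choice ex_mu.
  have -> : (fun i => psi (m i)) = (fun i => j (dr_psi (mu i))).
    apply/funext => i; have [cmu ->] := muP i.
    by rewrite psiP.2// gcs_psiE.
  apply: (gcs_psi_cuntz X_compact X_hausdorff T_local_homeo A_cstar E_deaconu fb).
    by move=> i; have [] := muP i.
  by move=> i; have [] := muP i.
split=> // [n m fb|n m fb a ca].
  by split=> [|a ca i]; [exact: psi_cuntz|exact: psi_iota].
(* The commutation relation brings [iota (beta a)] to the front, leaving the range projections,
   whose sum is 1. *)
rewrite (eq_bigr (fun i => iota (beta a) ** (psi (m i) ** cs_star (psi (m i))))).
  have [_ psi1] := psi_cuntz n m fb.
  by rewrite -cs_mul_sumr psi1 cs_mul1r.
by move=> i _; rewrite -psi_iota// cs_mulA.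
Qed.
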